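(* Let $T\in\mathcal{L}(\mathcal{H})$ have closed range, and write $T$ with respect to the orthogonal decomposition $\mathcal{H}=R(T^* )\oplus N(T)$ as $$T=\begin{bmatrix} T_1 & 0\\ T_2 & 0\end{bmatrix},\qquad T_1\in\mathcal{L}(R(T^* )),\quad T_2\in\mathcal{L}(R(T^* ),N(T)).$$ Let $p(z)=a_nz^n+a_{n-1}z^{n-1}+\cdots+a_0$ and $q(z)=a_nz^{n-1}+a_{n-1}z^{n-2}+\cdots+a_1$, where $a_0,a_1,\ldots,a_n\in\mathbb{C}$. Then the following statements are equivalent: (i) $T$ is $p$-hypo-EP; (ii) $T_2\,q(T_1)=0$. In addition, if $T$ is $p$-hypo-EP, then with respect to the same decomposition $$p(T)=\begin{bmatrix} p(T_1) & 0\\ 0 & a_0I\end{bmatrix}.$$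
   Context: $\mathcal{H}$ is a complex Hilbert space, $\mathcal{L}(\mathcal{H})$ is the algebra of bounded linear operators on $\mathcal{H}$, and $R(\cdot)$, $N(\cdot)$, ${}^*$ denote range, kernel and adjoint. For $T\in\mathcal{L}(\mathcal{H})$ with closed range, the Moore-Penrose inverse $T^\dagger$ is the unique operator with $TT^\dagger T=T$, $T^\dagger TT^\dagger=T^\dagger$, $(T^\dagger T)^*=T^\dagger T$, $(TT^\dagger)^*=TT^\dagger$. For a complex polynomial $p$ (the notion is introduced for nontrivial $p$), a closed range operator $T$ is $p$-hypo-EP ($p$-HEP) if $T^\dagger T\,p(T)=p(T)\,T^\dagger T$. Every closed range operator $T$ has a matrix representation of the displayed form, since $T$ vanishes on $N(T)=R(T^* )^\perp$. *)

(* Defs.v *)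
From HB Require Import structures.
From mathcomp Require Export all_boot all_order all_algebra.
From mathcomp Require Export sesquilinear.
From mathcomp.real_closed Require Export complex.
From mathcomp Require Export boolp classical_sets functions reals topology
  normedtype.

Set Implicit Arguments.
Unset Strict Implicit.
Unset Printing Implicit Defensive.

Import Order.TTheory GRing.Theory Num.Theory.
Import numFieldNormedType.Exports.
Local Open Scope classical_set_scope.
Local Open Scope ring_scope.

(* [{dot H for conj}] makes [inner] linear in its first argument and
   conjugate-linear in the second; the norm takes values in [R[i]]. *)
HB.mixin Record isHilbert (R : realType) H & CompleteNormedModule R[i] H := {
  inner : {dot H for @Num.conj R[i]};
  inner_normE : forall x : H, inner x x = `|x| ^+ 2
}.

#[short(type="hilbertType")]
HB.structure Definition Hilbert (R : realType) :=
  {H of CompleteNormedModule R[i] H & isHilbert R H}.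

HB.mixin Record isBoundedMap (K : numFieldType) (X Y : normedModType K)
    (f : X -> Y) := {
  bounded_subproof : bounded_near f (nbhs (0 : X))
}.

(* For linear maps this is |f x| <= M |x|, see [linear_boundedP]. *)
#[short(type="boundedOp")]
HB.structure Definition BoundedOp (K : numFieldType) (X Y : normedModType K) :=
  {f of @GRing.Linear K X Y *:%R f & isBoundedMap K X Y f}.

Section BoundedOpInstances.
Context {K : numFieldType}.
Implicit Types X Y Z : normedModType K.

HB.instance Definition _ X Y := gen_eqMixin (boundedOp X Y).
HB.instance Definition _ X Y := gen_choiceMixin (boundedOp X Y).

Lemma bounded_null X Y : bounded_near (\0 : X -> Y) (nbhs (0 : X)).
Proof. by apply/(linear_bounded_continuous \0) => x; exact: cvg_cst. Qed.

HB.instance Definition _ X Y :=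
  isBoundedMap.Build K X Y \0 (@bounded_null X Y).

Lemma bounded_comp X Y Z (f : boundedOp Y Z) (g : boundedOp X Y) :
  bounded_near (f \o g) (nbhs (0 : X)).
Proof.
apply/(linear_bounded_continuous (f \o g)) => x.
have ctn V W (h : boundedOp V W) : continuous h.
  by apply/linear_bounded_continuous; exact: bounded_subproof.
by apply: continuous_comp; exact: ctn.
Qed.

HB.instance Definition _ X Y Z (f : boundedOp Y Z) (g : boundedOp X Y) :=
  isBoundedMap.Build K X Z (f \o g) (bounded_comp f g).

End BoundedOpInstances.

Section Subspaces.
Context {K : numFieldType} {X : normedModType K}.

Record subspace (W : submodClosed X) :=
  Subspace { subspace_val :> X; subspaceP : subspace_val \in W }.

Context (W : submodClosed X).
HB.instance Definition _ := [isSub for @subspace_val W].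
HB.instance Definition _ := [Choice of subspace W by <:].
HB.instance Definition _ := [SubChoice_isSubLmodule of subspace W by <:].

Let subnorm (u : subspace W) : K := `|val u|.

Let ler_subnormD u v : subnorm (u + v) <= subnorm u + subnorm v.
Proof. by rewrite /subnorm raddfD ler_normD. Qed.

Let subnormZ (l : K) u : subnorm (l *: u) = `|l| * subnorm u.
Proof. by rewrite /subnorm linearZ normrZ. Qed.

Let subnorm_eq0 u : subnorm u = 0 -> u = 0.
Proof. by move=> /normr0_eq0 u0; apply: val_inj; rewrite u0 raddf0. Qed.

HB.instance Definition _ := Lmodule_isNormed.Build K (subspace W)
  ler_subnormD subnormZ subnorm_eq0.

End Subspaces.

Section RangeKernel.
Context {K : numFieldType} {X Y : normedModType K} (T : boundedOp X Y).

Definition op_range : {pred Y} := [pred y | `[< range T y >]].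
Definition op_ker : {pred X} := [pred x | T x == 0].

Lemma op_range_submod : submod_closed op_range.
Proof.
split; first by apply/asboolP; exists 0; rewrite ?raddf0.
move=> a _ _ /asboolP[x _ <-] /asboolP[y _ <-].
by apply/asboolP; exists (a *: x + y); rewrite ?linearP.
Qed.

Lemma op_ker_submod : submod_closed op_ker.
Proof.
split; first by rewrite inE raddf0.
move=> a x y; rewrite !inE => /eqP Tx0 /eqP Ty0.
have -> : T (a *: x + y) = a *: T x + T y by rewrite linearP.
by rewrite Tx0 Ty0 scaler0 addr0.
Qed.

HB.instance Definition _ := GRing.isSubmodClosed.Build K Y op_range
  (GRing.submod_closed_semi op_range_submod).
HB.instance Definition _ := GRing.isSubmodClosed.Build K X op_ker
  (GRing.submod_closed_semi op_ker_submod).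

End RangeKernel.

(* Not [horner_alg]: the operators on X = 0 do not form a nontrivial ring. *)
Definition op_poly {K : numFieldType} {X : normedModType K} (p : {poly K})
    (T : X -> X) (x : X) : X :=
  \sum_(i < size p) p`_i *: iter i T x.

(* [F] has matrix [[A, B], [C, D]] when X is the direct sum of V and W; that
   X = V + W is not part of the definition. *)
Definition is_block {K : numFieldType} {X : normedModType K}
    (V W : submodClosed X) (F : X -> X)
    (A : subspace V -> subspace V) (B : subspace W -> subspace V)
    (C : subspace V -> subspace W) (D : subspace W -> subspace W) :=
  forall (v : subspace V) (w : subspace W),
    F (val v + val w) = val (A v + B w) + val (C v + D w).
Arguments is_block {K X} V W F A B C D.

Section Operators.
Context {R : realType} {H K : hilbertType R}.

Definition is_adjoint (T : boundedOp H K) (S : boundedOp K H) :=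
  forall x y, inner (T x) y = inner x (S y).

(* The adjoint exists and is unique by completeness, so the default value 0 is
   never taken. *)
Definition adjoint (T : boundedOp H K) : boundedOp K H :=
  xget (\0 : boundedOp K H) [set S | is_adjoint T S].

End Operators.

Section HypoEP.
Context {R : realType}.
Implicit Types H K : hilbertType R.

Definition is_mpinv H K (T : boundedOp H K) (S : boundedOp K H) :=
  [/\ T \o S \o T = T :> boundedOp H K,
      S \o T \o S = S :> boundedOp K H,
      adjoint (S \o T) = S \o T :> boundedOp H H
    & adjoint (T \o S) = T \o S :> boundedOp K K].

(* A bounded Moore-Penrose inverse exists, and is unique, exactly when the range
   of [T] is closed; otherwise this is 0. *)
Definition mpinv H K (T : boundedOp H K) : boundedOp K H :=
  xget (\0 : boundedOp K H) [set S | is_mpinv T S].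

Definition hypo_ep H (p : {poly R[i]}) (T : boundedOp H H) :=
  closed (range T) /\
  mpinv T \o T \o op_poly p T = op_poly p T \o (mpinv T \o T).

End HypoEP.

(* Main.v *)
From HB Require Import structures.
Require Import Defs.
From mathcomp Require Import ring lra.
Set Implicit Arguments.
Unset Strict Implicit.
Unset Printing Implicit Defensive.

Import Order.TTheory GRing.Theory Num.Theory.
Import numFieldNormedType.Exports.
Local Open Scope classical_set_scope.
Local Open Scope complex_scope.
Local Open Scope ring_scope.

(** Let [P] be the orthogonal projection onto R(T^* ), so that [P = T^+ T] when
    the range of [T] is closed.  With respect to R(T^* ) + N(T) the powers of
    [T] are

      T^0 = [[I, 0], [0, I]]   and   T^(i+1) = [[T1^(i+1), 0], [T2 T1^i, 0]],

    whence p(T) = [[p(T1), 0], [T2 q(T1), a_0 I]] ([op_poly_block]).  As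
    P = [[I, 0], [0, 0]], the commutator of [P] and p(T) has [T2 q(T1)] as its
    only nonzero entry up to sign; it vanishes exactly when [T2 q(T1) = 0], and
    then p(T) is block diagonal.

    This argument relies on three facts of Hilbert space theory: the adjoint
    exists, an operator with closed range has a bounded Moore-Penrose inverse,
    and [T^+ T] is the identity on R(T^* ), has range in R(T^* ) and vanishes on
    N(T).  The first two come from one variational principle, [lax_milgram]: if
    an operator [L] is bounded below on a closed subspace [W], then
    |L z|^2 - 2 Re <F z, y> attains its minimum over [W], and the minimiser [w]
    satisfies Re <L h, L w> = Re <F h, y> for all [h] in [W].
    - With [L = id] and [W] the whole space this is the Riesz representation of
      h |-> <T h, y>, hence the adjoint ([adjoint_exists]); with [L = F = id] it
      is the orthogonal projection onto a closed subspace.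
    - With [L = T^*] and [W = R(T)] it gives [z] with T^* T T^* z = T^* y, and
      y |-> T^* z is the Moore-Penrose inverse ([mpinv_exists]): T^* z is the
      only least squares solution of T x = y that lies in R(T^* ).

    That [T^*] is bounded below on R(T) is where the closed range is used: each
    [x] pairs boundedly with the [y] in R(T) such that |T^* y| <= 1, because
    the projection of [x] on R(T) has the form T u and <y, T u> = <T^* y, u>; so
    such [y] are bounded in norm ([uniform_boundedness]).

    Real parts of inner products suffice throughout: the maps are
    complex-linear, so an identity between real parts that holds for all vectors
    implies the complex identity (replace x by ix). *)

(** * The real inner product *)

Lemma Re_conj (R : realType) (a : R[i]) :
  complex.Re (Num.conj a) = complex.Re a.
Proof. by case: a. Qed.

Section RealInner.
Context {R : realType} {H : hilbertType R}.
Implicit Types (x y z : H) (t : R) (a : R[i]).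

(** The norm of a Hilbert space over [R[i]] is [R[i]]-valued, and [R[i]] is only
    partially ordered; [nrm] is the same norm with values in the ordered field
    [R], where infima and linear arithmetic are available. *)
Definition nrm x : R := complex.Re `|x|.
Definition ip x y : R := complex.Re (inner x y).

Lemma nrmE x : `|x| = (nrm x)%:C.
Proof. by rewrite /nrm RRe_real// normr_real. Qed.

Lemma nrm_ge0 x : 0 <= nrm x.
Proof. by rewrite -ler0c -nrmE. Qed.

Lemma nrm_sqr x : nrm x ^+ 2 = ip x x.
Proof. by rewrite /ip inner_normE nrmE -rmorphXn. Qed.

Lemma ipC x y : ip x y = ip y x.
Proof. by rewrite /ip hermC expr0 mul1r Re_conj. Qed.

Lemma ipDl x y z : ip (x + y) z = ip x z + ip y z.
Proof. by rewrite /ip linearDl raddfD. Qed.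

Lemma ipDr x y z : ip z (x + y) = ip z x + ip z y.
Proof. by rewrite ![ip z _]ipC ipDl. Qed.

Lemma ipNl x z : ip (- x) z = - ip x z.
Proof. by rewrite /ip linearNl raddfN. Qed.

Lemma ipNr x z : ip z (- x) = - ip z x.
Proof. by rewrite ![ip z _]ipC ipNl. Qed.

Lemma ipBl x y z : ip (x - y) z = ip x z - ip y z.
Proof. by rewrite ipDl ipNl. Qed.

Lemma ipBr x y z : ip z (x - y) = ip z x - ip z y.
Proof. by rewrite ipDr ipNr. Qed.

Lemma ip_scale a x y : ip (a *: x) y = complex.Re (a * inner x y).
Proof. by rewrite /ip linearZl_LR. Qed.

Lemma ip_conj a x y : ip (Num.conj a *: x) y = ip x (a *: y).
Proof. by rewrite /ip linearZl_LR linearZr_LR. Qed.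

Lemma ipZl t x y : ip (t%:C *: x) y = t * ip x y.
Proof.
by rewrite ip_scale /ip; case: (inner x y) => r s /=; rewrite mul0r subr0.
Qed.

Lemma ipZr t x y : ip x (t%:C *: y) = t * ip x y.
Proof. by rewrite ipC ipZl ipC. Qed.

Lemma ip0l x : ip 0 x = 0.
Proof. by rewrite -(subrr 0) ipBl subrr. Qed.

Lemma ip0r x : ip x 0 = 0.
Proof. by rewrite ipC ip0l. Qed.

Lemma Im_inner x y : complex.Im (inner x y) = - ip ('i *: x) y.
Proof.
rewrite ip_scale; case: (inner x y) => r s /=.
by rewrite mul0r mul1r sub0r opprK.
Qed.

Lemma nrm_eq0 x : nrm x = 0 -> x = 0.
Proof. by move=> x0; apply/normr0_eq0; rewrite nrmE x0. Qed.

Lemma ip_eq0 x : ip x x = 0 -> x = 0.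
Proof. by rewrite -nrm_sqr => /eqP; rewrite sqrf_eq0 => /eqP/nrm_eq0. Qed.

Lemma ip_inj x y : (forall z, ip z x = ip z y) -> x = y.
Proof.
move=> xy; apply/eqP; rewrite -subr_eq0; apply/eqP/ip_eq0.
by rewrite ipBr xy subrr.
Qed.

Lemma nrmZ t x : nrm (t%:C *: x) = `|t| * nrm x.
Proof.
apply: complexI; rewrite -nrmE normrZ nrmE rmorphM /=; congr (_ * _).
by rewrite normc_def /= expr0n addr0 sqrtr_sqr.
Qed.

Lemma nrm0 : nrm 0 = 0 :> R.
Proof. by rewrite /nrm normr0. Qed.

Lemma nrmN x : nrm (- x) = nrm x.
Proof. by rewrite /nrm normrN. Qed.

Lemma nrmD x y : nrm (x + y) <= nrm x + nrm y.
Proof. by rewrite -lecR rmorphD/= -!nrmE ler_normD. Qed.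

Lemma nrmBC x y : nrm (x - y) = nrm (y - x).
Proof. by rewrite -nrmN opprB. Qed.

Lemma cauchy_schwarz x y : `|ip x y| <= nrm x * nrm y.
Proof.
have [y0|y0] := eqVneq (nrm y) 0.
  by rewrite (nrm_eq0 y0) ip0r nrm0 mulr0 normr0.
have yp : 0 < nrm y by rewrite lt_def y0 nrm_ge0.
rewrite -(@ler_pXn2r _ 2) ?nnegrE ?mulr_ge0 ?nrm_ge0// exprMn.
rewrite -normrX ger0_norm ?sqr_ge0//.
(* Up to the factor |y|^2 this is x minus its projection on the real line
   through y. *)
have := sqr_ge0 (nrm ((nrm y ^+ 2)%:C *: x - (ip x y)%:C *: y)).
rewrite [leRHS]nrm_sqr ipBl !ipBr !ipZl !ipZr -!nrm_sqr (ipC y x).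
set n := nrm y; set m := nrm x; set c := ip x y => h.
have : 0 <= n ^+ 2 * (m ^+ 2 * n ^+ 2 - c ^+ 2) by lra.
by rewrite pmulr_rge0 ?exprn_gt0// subr_ge0.
Qed.

Lemma ip_le x y : ip x y <= nrm x * nrm y.
Proof. exact: le_trans (ler_norm _) (cauchy_schwarz _ _). Qed.

End RealInner.

(** * Bounded operators *)

Section Bounded.
Context {R : realType} {H K : hilbertType R}.

Lemma bounded_nrm (F : boundedOp H K) :
  exists2 M : R, 0 < M & forall x, nrm (F x) <= M * nrm x.
Proof.
have /linear_boundedP [r [rr hr]] := @bounded_subproof _ _ _ F.
(* r may be negative, whereas a positive constant is wanted. *)
pose s := r + `|r| + 1.
have s0 : 0 < s.
  rewrite /s; apply: ltr_wpDl => //.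
  by rewrite addrC -[X in _ + X]opprK subr_ge0 -normrN real_ler_norm// realN.
have rs : r < s.
  by rewrite /s -addrA ltrDl; apply: ltr_wpDl; rewrite ?normr_ge0 ?ltr01.
have hs := hr _ rs.
have sE : (complex.Re s)%:C = s by rewrite RRe_real// gtr0_real.
exists (complex.Re s) => [|x]; first by rewrite -ltcR sE.
by rewrite -lecR rmorphM /= sE -!nrmE; exact: hs.
Qed.

Lemma opD (F : boundedOp H K) x y : F (x + y) = F x + F y.
Proof. exact: linearD. Qed.

Lemma opB (F : boundedOp H K) x y : F (x - y) = F x - F y.
Proof. exact: linearB. Qed.

Lemma opZ (F : boundedOp H K) a x : F (a *: x) = a *: F x.
Proof. exact: linearZ. Qed.

Lemma op0 (F : boundedOp H K) : F 0 = 0.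
Proof. exact: linear0. Qed.

(** Operators are obtained below by choosing a value at each point;
    linearity then follows from uniqueness of that value, and this lemma packs
    the resulting function. *)
Lemma boundedOp_intro (f : H -> K) (M : R) :
  (forall a x y, f (a *: x + y) = a *: f x + f y) ->
  (forall x, nrm (f x) <= M * nrm x) -> exists F : boundedOp H K, F =1 f.
Proof.
move=> lf bf.
pose g : {linear H -> K} := HB.pack f (GRing.isLinear.Build _ _ _ _ _ lf).
have bg : bounded_near g (nbhs 0).
  apply/bounded_funP => r.
  exists ((`|M|)%:C * r) => x xr.
  apply: (@le_trans _ _ ((`|M|)%:C * `|x|)); last first.
    by rewrite ler_wpM2l// ler0c.
  rewrite !nrmE -rmorphM lecR; apply: le_trans (bf x) _.
  by rewrite ler_wpM2r ?nrm_ge0// ler_norm.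
pose F : boundedOp H K := HB.pack f (GRing.isLinear.Build _ _ _ _ _ lf)
  (isBoundedMap.Build _ _ _ f bg).
by exists F.
Qed.

Lemma boundedOp_eq (F G : boundedOp H K) : F =1 G -> F = G.
Proof.
case: F G => [f [[fA] [fL] [fB]]] [g [[gA] [gL] [gB]]] /= /funext fg.
rewrite /= in fg; subst g.
by rewrite (Prop_irrelevance fA gA) (Prop_irrelevance fL gL)
  (Prop_irrelevance fB gB).
Qed.

Lemma is_adjoint_ip (T : boundedOp H K) (S : boundedOp K H) :
  (forall x y, ip (T x) y = ip x (S y)) -> is_adjoint T S.
Proof.
move=> h x y; apply/eqP; rewrite eq_complex; apply/andP; split; apply/eqP.
  exact: h.
(* Im <x, y> = - Re <ix, y>, to which the hypothesis applies as T is linear. *)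
by rewrite !Im_inner -linearZ h.
Qed.

End Bounded.

(** * Convergence of sequences *)

Section Sequences.
Context {R : realType} {H : hilbertType R}.
Implicit Types (u : nat -> H) (l x y : H).

Lemma cvg_nrmP u l : u @ \oo --> l <->
  forall e : R, 0 < e -> exists N, forall k, (N <= k)%N -> nrm (l - u k) < e.
Proof.
split=> [/cvgrPdist_lt ul e e0|ul].
  have /ul : 0 < e%:C by rewrite ltcR.
  by case=> N _ hN; exists N => k /hN /=; rewrite nrmE ltcR.
apply/cvgrPdist_lt => e e0.
have eE : (complex.Re e)%:C = e by rewrite RRe_real// gtr0_real.
have /ul[N hN] : 0 < complex.Re e by rewrite -ltcR eE.
by exists N => // k /= /hN; rewrite -ltcR eE -nrmE.
Qed.

Lemma cauchy_nrm_cvg u :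
  (forall e : R, 0 < e -> exists N, forall j k,
    (N <= j)%N -> (N <= k)%N -> nrm (u j - u k) < e) ->
  exists l, u @ \oo --> l.
Proof.
move=> cu; apply/cvg_ex.
suff /cauchy_exP : cauchy_ex (u @ \oo) by exact: cauchy_cvg.
move=> e e0.
have eE : (complex.Re e)%:C = e by rewrite RRe_real// gtr0_real.
have /cu[N hN] : 0 < complex.Re e by rewrite -ltcR eE.
exists (u N); exists N => // k /= Nk.
by rewrite -ball_normE /= nrmE -eE ltcR hN.
Qed.

Lemma closed_cvg_seq (W : set H) u l :
  closed W -> (forall k, W (u k)) -> u @ \oo --> l -> W l.
Proof.
by move=> cW Wu ul; apply: (closed_cvg _ cW _ _ ul) => //; exact: nearW.
Qed.

End Sequences.

(** * A variational principle *)

(** First-order condition at an approximate minimiser: a quadratic function of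
    [t] whose value at 0 is within [e] of its infimum has a derivative at 0 of
    order [sqrt e]. *)
Lemma quadratic_bound (R : realType) (A g e : R) : 0 <= A ->
  (forall t : R, - e <= t ^+ 2 * A + 2 * t * g) -> g ^+ 2 <= e * (A + 1).
Proof.
(* The optimal t would be - g / A; the shift by 1 covers the case A = 0. *)
move=> A0 /(_ (- g / (A + 1))) h.
have A1 : 0 < A + 1 by lra.
rewrite -ler_pdivrMr//.
apply: (@le_trans _ _ (g ^+ 2 * (A + 2) / (A + 1) ^+ 2)); last first.
  suff -> : g ^+ 2 * (A + 2) / (A + 1) ^+ 2 =
    - ((- g / (A + 1)) ^+ 2 * A + 2 * (- g / (A + 1)) * g) by lra.
  by field; lra.
rewrite -subr_ge0 (_ : _ - _ = g ^+ 2 / (A + 1) ^+ 2).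
  by rewrite divr_ge0 ?sqr_ge0.
by field; lra.
Qed.

Section LaxMilgram.
Context {R : realType} {V G E : hilbertType R}.
Implicit Types (L : boundedOp V G) (F : boundedOp V E).

(** The representation theorem for the form <L h, L w> on [W], which is coercive
    there because [L] is bounded below.  A minimising sequence of the energy
    [J] is Cauchy by the parallelogram identity, and [quadratic_bound] makes its
    limit satisfy the Euler equation without appeal to the continuity of [J]. *)
Lemma lax_milgram L F (y : E) (W : set V) (M : R) :
  closed W -> W 0 -> (forall a u v, W u -> W v -> W (a *: u + v)) ->
  (forall z, W z -> nrm z <= M * nrm (L z)) ->
  exists2 w, W w & forall h, W h -> ip (L h) (L w) = ip (F h) y.
Proof.
move=> cW W0 sW coer.
have [C C0 hC] := bounded_nrm F.
have [B B0 hB] := bounded_nrm L.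
pose J z : R := nrm (L z) ^+ 2 - 2 * ip (F z) y.
have Jlb z : W z -> - (C * M * nrm y) ^+ 2 <= J z.
  move=> Wz; rewrite /J; set D := C * M * nrm y; set t := nrm (L z).
  have h : ip (F z) y <= D * t.
    apply: le_trans (ip_le _ _) _.
    rewrite (_ : D * t = C * (M * t) * nrm y); last by rewrite /D; ring.
    rewrite ler_wpM2r ?nrm_ge0//; apply: le_trans (hC z) _.
    by rewrite ler_wpM2l ?(ltW C0)// coer.
  have := sqr_ge0 (t - D); lra.
have infJ : has_inf (J @` W).
  split; first by exists (J 0); exists 0.
  by exists (- (C * M * nrm y) ^+ 2) => _ [z Wz <-]; exact: Jlb.
pose m := inf (J @` W).
have Jm z : W z -> m <= J z.
  by move=> Wz; apply: ge_inf; [case: infJ|exists z].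
have exz (k : nat) : exists z, W z /\ J z < m + k.+1%:R^-1.
  have k0 : 0 < k.+1%:R^-1 :> R by rewrite invr_gt0.
  by have [_ [z Wz <-] h] := inf_adherent k0 infJ; exists z.
have [z hz] := choice exz.
have Wz k : W (z k) by case: (hz k).
have Jz k : J (z k) < m + k.+1%:R^-1 by case: (hz k).
(* Parallelogram identity; the energy of the midpoint is at least m. *)
have gap a b : W a -> W b ->
    nrm (L (a - b)) ^+ 2 <= 2 * (J a - m) + 2 * (J b - m).
  move=> Wa Wb.
  have Wmid : W ((2^-1 : R)%:C *: (a + b)).
    rewrite -[X in W X]addr0; apply: (sW) => //.
    by rewrite -[a]scale1r; exact: sW.
  have := Jm _ Wmid; rewrite /J !nrm_sqr !opZ opB !opD.
  rewrite !(ipZl, ipZr) !(ipBl, ipBr) !(ipDl, ipDr) (ipC (L b) (L a)).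
  lra.
have epsN (e : R) : 0 < e -> exists N, forall k : nat, (N <= k)%N ->
    k.+1%:R^-1 < e.
  move=> e0; exists (Num.truncn e^-1) => k Nk.
  have e1 : 0 < e^-1 by rewrite invr_gt0.
  rewrite -[e]invrK ltf_pV2 ?posrE ?ltr0Sn//.
  have := truncnS_gt (e^-1); move/lt_le_trans; apply.
  by rewrite ler_nat ltnS.
have [w zw] : exists w : V, z @ \oo --> w.
  apply: cauchy_nrm_cvg => e e0.
  have M1 : 0 < M ^+ 2 + 1 by have := sqr_ge0 M; lra.
  (* By gap and coercivity, |z j - z k|^2 is below M^2 times four times this
     quantity. *)
  have /epsN[N hN] : 0 < e ^+ 2 / (4 * (M ^+ 2 + 1)).
    by rewrite divr_gt0 ?exprn_gt0// mulr_gt0.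
  exists N => j k /hN hj /hN hk.
  rewrite -(@ltr_pXn2r _ 2) ?nnegrE ?nrm_ge0 ?(ltW e0)//.
  have Wjk : W (z j - z k) by rewrite addrC -scaleN1r; exact: sW.
  have h1 : nrm (z j - z k) ^+ 2 <= M ^+ 2 * nrm (L (z j - z k)) ^+ 2.
    rewrite -exprMn ler_pXn2r ?nnegrE ?nrm_ge0 ?coer//.
    exact: le_trans (nrm_ge0 _) (coer _ Wjk).
  have h2 := gap _ _ (Wz j) (Wz k).
  have h3 : nrm (L (z j - z k)) ^+ 2 < e ^+ 2 / (M ^+ 2 + 1).
    have -> : e ^+ 2 / (M ^+ 2 + 1) = 4 * (e ^+ 2 / (4 * (M ^+ 2 + 1))).
      by field; rewrite lt0r_neq0.
    (* The inverses are abstracted so that the goal becomes linear. *)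
    move: (Jz j) (Jz k) hj hk h2.
    move: (_ ^+ 2 / _) (_^-1) (_^-1) (nrm _ ^+ 2) (J _) (J _) => X p q s t r.
    lra.
  apply: le_lt_trans h1 _.
  move: h3; rewrite ltr_pdivlMr// => h3.
  have := sqr_ge0 (nrm (L (z j - z k))); lra.
exists w => [|h Wh]; first exact: closed_cvg_seq zw.
(* g is the residual of the Euler equation at h. *)
set g := ip (L h) (L w) - ip (F h) y.
suff g0 : g = 0 by apply/eqP; rewrite -subr_eq0 -/g g0.
have gk k : (ip (L h) (L (z k)) - ip (F h) y) ^+ 2
    <= k.+1%:R^-1 * (nrm (L h) ^+ 2 + 1).
  apply: quadratic_bound => [|t]; first exact: sqr_ge0.
  have Wt : W (t%:C *: h + z k) by exact: sW.
  have := Jm _ Wt; have := Jz k; rewrite /J !nrm_sqr !opD !opZ.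
  rewrite !(ipDl, ipDr) !(ipZl, ipZr) (ipC (L (z k)) (L h)).
  move: (_^-1) (ip (L h) _) (ip (L h) _) (ip (L _) _) (ip (F h) _) (ip (F _) _).
  by move=> a b c d e f; lra.
(* If g were nonzero, some z k would be so close to w that the two halves of g
   below are each smaller than |g| / 2. *)
apply/eqP; apply: contraT => g0.
have gp : 0 < `|g| by rewrite normr_gt0.
have A1 : 0 < nrm (L h) ^+ 2 + 1 by have := sqr_ge0 (nrm (L h)); lra.
have B1 : 0 < nrm (L h) * B + 1.
  by have := mulr_ge0 (nrm_ge0 (L h)) (ltW B0); lra.
have /epsN[N hN] : 0 < (`|g| / 2) ^+ 2 / (nrm (L h) ^+ 2 + 1).
  by rewrite divr_gt0 ?exprn_gt0 ?divr_gt0.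
have [|N' hN'] := (cvg_nrmP _ _).1 zw (`|g| / 2 / (nrm (L h) * B + 1)).
  by rewrite !divr_gt0.
pose k := maxn N N'.
have /hN h1 : (N <= k)%N by rewrite leq_maxl.
have /hN' h2 : (N' <= k)%N by rewrite leq_maxr.
have h3 : `|ip (L h) (L (z k)) - ip (F h) y| < `|g| / 2.
  rewrite -(@ltr_pXn2r _ 2) ?nnegrE//; last by rewrite divr_ge0.
  rewrite -normrX ger0_norm ?sqr_ge0//.
  by apply: le_lt_trans (gk k) _; rewrite -ltr_pdivlMr.
have h4 : `|ip (L h) (L (w - z k))| < `|g| / 2.
  apply: le_lt_trans (cauchy_schwarz _ _) _.
  apply: (@le_lt_trans _ _ (nrm (L h) * B * nrm (w - z k))).
    by rewrite -mulrA ler_wpM2l ?nrm_ge0.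
  move: h2; rewrite ltr_pdivlMr// mulrC => h2.
  have := nrm_ge0 (w - z k); lra.
have : `|g| < `|g| / 2 + `|g| / 2.
  have {1}-> : g = ip (L h) (L (z k)) - ip (F h) y + ip (L h) (L (w - z k)).
    by rewrite opB ipBr /g; ring.
  by apply: le_lt_trans (ler_normD _ _) _; exact: ltrD.
lra.
Qed.

End LaxMilgram.

(** * Adjoints *)

Section Adjoint.
Context {R : realType}.
Implicit Types H K : hilbertType R.

Lemma id_boundedOp H : exists I : boundedOp H H, I =1 id.
Proof.
by apply: (@boundedOp_intro _ _ _ id 1) => // x; rewrite mul1r.
Qed.

Lemma orthogonal_projection H (W : set H) (x : H) :
  closed W -> W 0 -> (forall a u v, W u -> W v -> W (a *: u + v)) ->
  exists2 w, W w & forall h, W h -> ip h w = ip h x.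
Proof.
move=> cW W0 sW; have [I IE] := id_boundedOp H.
have [|w Ww hw] := @lax_milgram _ _ _ _ I I x W 1 cW W0 sW.
  by move=> z _; rewrite mul1r IE.
by exists w => // h /hw; rewrite !IE.
Qed.

(** The Riesz representative [S y] of h |-> <T h, y> is unique, hence linear in
    [y]; it is bounded because |S y|^2 = <T (S y), y>. *)
Lemma adjoint_exists H K (T : boundedOp H K) :
  exists S : boundedOp K H, is_adjoint T S.
Proof.
have [I IE] := id_boundedOp H.
have riesz y : exists w, forall h, ip h w = ip (T h) y.
  have [||||w _ hw] := @lax_milgram _ _ _ _ I T y setT 1 => //.
  - by move=> z _; rewrite mul1r IE.
  - by exists w => h; rewrite -hw// !IE.
have [S hS] := choice riesz.
have [M M0 hM] := bounded_nrm T.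
have [||S' S'E] := @boundedOp_intro _ _ _ S M.
- move=> a x y; apply: ip_inj => h.
  by rewrite ipDr -ip_conj !hS opZ ipDr ip_conj.
- move=> y; have [->|S0] := eqVneq (S y) 0.
    by rewrite nrm0 mulr_ge0 ?nrm_ge0// ltW.
  have Sp : 0 < nrm (S y).
    by rewrite lt_def nrm_ge0 andbT; apply: contraNneq S0 => /nrm_eq0->.
  rewrite -(ler_pM2l Sp) -expr2 nrm_sqr hS.
  apply: le_trans (ip_le _ _) _; rewrite mulrA (mulrC (nrm _) M).
  by rewrite ler_wpM2r ?nrm_ge0.
- by exists S'; apply: is_adjoint_ip => x y; rewrite S'E hS.
Qed.

Lemma adjointP H K (T : boundedOp H K) : is_adjoint T (adjoint T).
Proof. by apply: xgetPex; exact: adjoint_exists. Qed.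

Lemma ip_adjoint H K (T : boundedOp H K) x y : ip (T x) y = ip x (adjoint T y).
Proof. by rewrite /ip adjointP. Qed.

Lemma adjoint_unique H K (T : boundedOp H K) (S : boundedOp K H) :
  (forall x y, ip (T x) y = ip x (S y)) -> adjoint T = S.
Proof.
move=> h; apply: boundedOp_eq => y; apply: ip_inj => x.
by rewrite -ip_adjoint h.
Qed.

End Adjoint.

(** * Uniform boundedness *)

Section UniformBoundedness.
Context {R : realType} {H : hilbertType R}.
Implicit Types (x y : H) (A : set H).

(** Moving [x] by [r] along [y], in the direction that does not bring [ip x y]
    closer to 0. *)
Lemma push_away x y (r : R) : 0 <= r ->
  exists x', nrm (x' - x) <= r /\ r * nrm y <= `|ip x' y|.
Proof.
move=> r0; have [y0|y0] := eqVneq (nrm y) 0.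
  by exists x; rewrite subrr nrm0 y0 mulr0.
have yp : 0 < nrm y by rewrite lt_def y0 nrm_ge0.
pose d := r / nrm y.
have d0 : 0 <= d by rewrite divr_ge0 ?nrm_ge0.
have dE : d * nrm y = r by rewrite /d divfK.
have [i0|i0] := leP 0 (ip x y).
  exists (x + d%:C *: y).
  rewrite addrAC subrr add0r nrmZ ger0_norm// dE; split=> //.
  rewrite ipDl ipZl -nrm_sqr expr2 mulrA dE.
  by rewrite ger0_norm ?addr_ge0 ?mulr_ge0 ?nrm_ge0// lerDr.
exists (x - d%:C *: y).
rewrite addrAC subrr add0r nrmN nrmZ ger0_norm// dE; split=> //.
rewrite ipBl ipZl -nrm_sqr expr2 mulrA dE.
have rn : 0 <= r * nrm y by rewrite mulr_ge0 ?nrm_ge0.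
rewrite ler0_norm; lra.
Qed.

(** Gliding hump.  If [A] were unbounded, take [y n] in [A] with norm above
    [2 n 3^n] and, for [n > 0], let [x n] be obtained from [x (n - 1)] by a push
    of size [3^-n] along [y n].  All later pushes together have size at most
    [3^-n / 2], so the limit [l] still satisfies
    [`|ip l (y n)| >= 3^-n * nrm (y n) / 2 >= n], and the pairings of [l] with
    [A] are unbounded. *)
Lemma uniform_boundedness A :
  (forall x, exists C : R, forall y, A y -> `|ip x y| <= C) ->
  exists M : R, forall y, A y -> nrm y <= M.
Proof.
move=> pw; apply: contrapT => nub.
have big (k : nat) : exists y, A y /\ 2 * k%:R * 3 ^+ k < nrm y.
  apply: contrapT => nk; apply: nub; exists (2 * k%:R * 3 ^+ k) => y Ay.
  by rewrite leNgt; apply/negP => ?; apply: nk; exists y.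
have [y hy] := choice big.
have step (kx : nat * H) : exists x',
    nrm (x' - kx.2) <= 3^-1 ^+ kx.1 /\
    3^-1 ^+ kx.1 * nrm (y kx.1) <= `|ip x' (y kx.1)|.
  by apply: push_away; rewrite exprn_ge0 ?invr_ge0 ?ler0n.
have [f hf] := choice step.
pose x := fix x n := if n is k.+1 then f (k.+1, x k) else 0.
pose q : R := 3^-1.
have q0 n : 0 < q ^+ n by rewrite exprn_gt0 ?invr_gt0 ?ltr0n.
(* The tail of the geometric series of ratio 1/3 after n sums to half of its
   n-th term. *)
have dist n k : nrm (x (n + k)%N - x n) <= 2^-1 * (q ^+ n - q ^+ (n + k)).
  elim: k => [|k IH]; first by rewrite addn0 !subrr nrm0 mulr0.
  rewrite addnS -(subrK (x (n + k)%N) (x (n + k).+1)) -addrA.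
  apply: le_trans (nrmD _ _) _.
  have [h _] := hf ((n + k).+1, x (n + k)%N).
  have qS : q ^+ (n + k) = 3 * q ^+ (n + k).+1.
    by rewrite exprS mulrA divff ?mul1r ?pnatr_eq0.
  move: IH h; rewrite /= -/q qS; lra.
have distle n k : (n <= k)%N -> nrm (x k - x n) <= 2^-1 * q ^+ n.
  move=> /subnKC <-; apply: le_trans (dist _ _) _.
  by have := q0 k; have := q0 (n + (k - n))%N; lra.
have small (e : R) : 0 < e -> exists N, q ^+ N < e.
  move=> e0; exists (Num.truncn e^-1).+1.
  have e1 : 0 < e^-1 by rewrite invr_gt0.
  rewrite -[ltRHS]invrK exprVn ltf_pV2 ?posrE ?exprn_gt0//.
  have := truncnS_gt (e^-1); move/lt_trans; apply.
  by rewrite -natrX ltr_nat ltn_expl.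
have [l xl] : exists l : H, x @ \oo --> l.
  apply: cauchy_nrm_cvg => e /small[N hN]; exists N => j k Nj Nk.
  rewrite -(subrK (x N) (x j)) -addrA; apply: le_lt_trans (nrmD _ _) _.
  have := distle _ _ Nj; have := distle _ _ Nk; rewrite (nrmBC (x k)).
  lra.
have xln n : nrm (l - x n) <= 2^-1 * q ^+ n.
  apply/ler_addgt0Pr => e /((cvg_nrmP _ _).1 xl)[N hN].
  have := distle _ _ (leq_maxl n N); have := hN _ (leq_maxr n N).
  set z := x (maxn n N) => h1 h2.
  rewrite -(subrK z l) -addrA; apply: le_trans (nrmD _ _) _; lra.
have [C hC] := pw l.
have C0 : 0 <= C by case: (hy 0%N) => /hC + _; exact: le_trans.
pose n := (Num.truncn C).+1.
have Cn : C < n%:R by exact: truncnS_gt.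
have [Ayn yn] := hy n.
have := hC _ Ayn; rewrite leNgt => /negP; apply; apply: lt_le_trans Cn _.
have lower : q ^+ n * nrm (y n) <= `|ip (x n) (y n)|.
  by have [_] := hf (n, x n.-1).
have err : `|ip (l - x n) (y n)| <= 2^-1 * q ^+ n * nrm (y n).
  apply: le_trans (cauchy_schwarz _ _) _.
  by rewrite ler_wpM2r ?nrm_ge0.
have big' : 2 * n%:R <= q ^+ n * nrm (y n).
  rewrite exprVn ler_pdivlMl ?exprn_gt0// mulrC; exact: ltW.
have tri : `|ip (x n) (y n)| <= `|ip l (y n)| + `|ip (l - x n) (y n)|.
  rewrite -[X in _ <= _ + X]normrN; apply: le_trans (ler_normD _ _).
  by rewrite -ipNl -ipDl opprB addrC subrK.
lra.
Qed.

End UniformBoundedness.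

(** * The Moore-Penrose inverse *)

Section Range.
Context {R : realType} {H K : hilbertType R}.
Implicit Types (T : boundedOp H K).

Lemma range_linear T a u v : range T u -> range T v -> range T (a *: u + v).
Proof.
by move=> [x _ <-] [y _ <-]; exists (a *: x + y); rewrite // opD opZ.
Qed.

Lemma range0 T : range T 0.
Proof. by exists 0 => //; exact: op0. Qed.

End Range.

Section MoorePenrose.
Context {R : realType} {H K : hilbertType R}.
Implicit Types (T : boundedOp H K).

(** The pairings of a fixed [x] with the [y] in R(T) such that |T^* y| <= 1 are
    bounded: only the projection of [x] on R(T) matters, that projection has the
    form [T u] because the range is closed, and <y, T u> = <T^* y, u>. *)
Lemma adjoint_bounded_below T : closed (range T) ->
  exists M : R, forall y, range T y -> nrm y <= M * nrm (adjoint T y).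
Proof.
move=> cT.
pose A := [set y | range T y /\ nrm (adjoint T y) <= 1].
have [|M hM] := @uniform_boundedness _ _ A.
  move=> x.
  have [_ [u _ <-] hu] :=
    orthogonal_projection x cT (range0 T) (@range_linear _ _ _ T).
  exists (nrm u) => y [Ty y1].
  rewrite ipC -hu// ipC ip_adjoint; apply: le_trans (cauchy_schwarz _ _) _.
  by rewrite -[leRHS]mulr1 ler_wpM2l ?nrm_ge0.
exists M => y Ty; set t := nrm (adjoint T y).
have [t0|t0] := eqVneq t 0.
  have Tay := nrm_eq0 t0; case: Ty => x _ xy.
  suff y0 : y = 0 by rewrite /t Tay y0 !nrm0 mulr0.
  by apply: ip_eq0; rewrite -{1}xy ip_adjoint Tay ip0r.
have tp : 0 < t by rewrite lt_def t0 nrm_ge0.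
have /hM : A ((t^-1)%:C *: y).
  split.
    rewrite -[X in range T X]addr0; apply: range_linear => //; exact: range0.
  by rewrite opZ nrmZ ger0_norm ?invr_ge0 ?(ltW tp)// mulVf.
by rewrite nrmZ ger0_norm ?invr_ge0 ?(ltW tp)// ler_pdivrMl// mulrC.
Qed.

(** [S y] is the unique vector of R(T^* ) with T^* T (S y) = T^* y, the normal
    equation of T x = y.  The four Penrose identities are consequences of this
    characterisation: T S and S T are the orthogonal projections onto R(T) and
    onto R(T^* ). *)
Lemma mpinv_exists T : closed (range T) -> exists S, is_mpinv T S.
Proof.
move=> cT; have [M hM] := adjoint_bounded_below cT.
have [I IE] := id_boundedOp K.
have ex y : exists z, range T z /\
    forall h, range T h -> ip (adjoint T h) (adjoint T z) = ip h y.
  have [z Tz hz] :=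
    @lax_milgram _ _ _ _ (adjoint T) I y _ M cT (range0 T)
      (@range_linear _ _ _ T) hM.
  by exists z; split=> // h /hz ->; rewrite IE.
have [Z hZ] := choice ex.
pose S y := adjoint T (Z y).
have normal x y : ip (T x) (T (S y)) = ip (T x) y.
  have [_ <-] := hZ y; last by exists x.
  by rewrite ipC ip_adjoint ipC.
have uniq y u : range (adjoint T) u ->
    (forall x, ip (T x) (T u) = ip (T x) y) -> u = S y.
  move=> [z _ <-] hu; apply/eqP; rewrite -subr_eq0; apply/eqP/ip_eq0.
  set d := _ - _.
  have Td : T d = 0 by apply: ip_eq0; rewrite {2}opB ipBr normal hu subrr.
  have dE : d = adjoint T (z - Z y) by rewrite opB.
  by rewrite {2}dE -ip_adjoint Td ip0l.
have [||S' S'E] := @boundedOp_intro _ _ _ S `|M|.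
- move=> a x y; apply/esym/uniq; first exact/range_linear.
  by move=> h; rewrite opD opZ ipDr -ip_conj -opZ !normal ipDr opZ ip_conj.
- (* |T^* z|^2 = Re <z, y> <= |z| |y| <= M |T^* z| |y| for S y = T^* z. *)
  move=> y; have [S0|S0] := eqVneq (nrm (S y)) 0.
    by rewrite S0 mulr_ge0 ?nrm_ge0.
  have Sp : 0 < nrm (S y) by rewrite lt_def S0 nrm_ge0.
  have [Tz hz] := hZ y.
  rewrite -(ler_pM2l Sp) -expr2 nrm_sqr hz//.
  apply: le_trans (ip_le _ _) _; rewrite mulrA (mulrC (nrm (S y))).
  rewrite ler_wpM2r ?nrm_ge0//; apply: le_trans (hM _ Tz) _.
  by rewrite ler_wpM2r ?nrm_ge0 ?ler_norm.
(* By the normal equation, S (T x) - x lies in the kernel of T. *)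
have STx x : T (S (T x)) = T x.
  apply/eqP; rewrite -subr_eq0 -opB; apply/eqP/ip_eq0.
  by rewrite {2}opB ipBr normal subrr.
have perp x y : T x = 0 -> ip x (S y) = 0.
  by move=> Tx; rewrite -ip_adjoint Tx ip0l.
exists S'; split.
- by apply: boundedOp_eq => x /=; rewrite S'E STx.
- apply: boundedOp_eq => y /=; rewrite !S'E; apply/esym/uniq.
    by exists (Z y).
  by move=> x; rewrite normal.
- apply: adjoint_unique => x y /=; rewrite !S'E.
  have STd z : T (z - S (T z)) = 0 by rewrite opB STx subrr.
  have h1 := perp _ (T y) (STd x); have h2 := perp _ (T x) (STd y).
  move: h1 h2; rewrite !ipBl (ipC (S (T y)) (S (T x))) (ipC y).
  lra.
- apply: adjoint_unique => x y /=; rewrite !S'E.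
  by rewrite -normal ipC normal ipC.
Qed.

Lemma mpinvP T : closed (range T) -> is_mpinv T (mpinv T).
Proof. by move=> cT; apply: xgetPex; exact: mpinv_exists. Qed.

End MoorePenrose.

(** * The projection onto the range of the adjoint *)

Section SupportProjection.
Context {R : realType} {H : hilbertType R} (T : boundedOp H H).
Context (cT : closed (range T)).

Let P x := mpinv T (T x).

Lemma op_mpinvK x : T (mpinv T (T x)) = T x.
Proof. by case: (mpinvP cT) => /(congr1 (fun F : boundedOp _ _ => F x)). Qed.

Lemma mpinv_support_sym x y : ip (P x) y = ip x (P y).
Proof.
by case: (mpinvP cT) => _ _ sa _; rewrite (ip_adjoint (mpinv T \o T)) sa.
Qed.

(** [P] is self-adjoint, so P = P^* = T^* (T^+)^*. *)
Lemma mpinv_support_range x : P x \in op_range (adjoint T).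
Proof.
apply/asboolP; exists (adjoint (mpinv T) x) => //.
by apply: ip_inj => z; rewrite -!ip_adjoint mpinv_support_sym.
Qed.

(** P T^* = (T P)^* = T^*. *)
Lemma mpinv_support_fix v : v \in op_range (adjoint T) -> P v = v.
Proof.
move=> /asboolP[y _ <-]; apply: ip_inj => z.
by rewrite -mpinv_support_sym -!ip_adjoint op_mpinvK.
Qed.

Lemma mpinv_support_ker w : w \in op_ker T -> P w = 0.
Proof. by rewrite inE => /eqP Tw; rewrite /P Tw op0. Qed.

Lemma sub_mpinv_support x : x - P x \in op_ker T.
Proof. by rewrite inE opB op_mpinvK subrr. Qed.

End SupportProjection.

(** * Polynomials of a block operator with zero second column *)

Section BlockPolynomial.
Context {K : numFieldType} {X : normedModType K}.

(** The leading coefficients may vanish, so that the size of the polynomial may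
    be smaller than [m]. *)
Lemma op_poly_poly (Y : normedModType K) (m : nat) (c : nat -> K)
    (F : Y -> Y) (x : Y) :
  op_poly (\poly_(i < m) c i) F x = \sum_(i < m) c i *: iter i F x.
Proof.
set p := \poly_(i < m) c i.
rewrite /op_poly (big_ord_widen m (fun i => p`_i *: iter i F x)) ?size_poly//.
rewrite big_mkcond; apply: eq_bigr => i _; rewrite coef_poly ltn_ord.
case: ifP => // /negbT; rewrite -leqNgt => /leq_sizeP.
by move/(_ _ (leqnn _)); rewrite coef_poly ltn_ord => ->; rewrite scale0r.
Qed.

Context (V W : submodClosed X) (F : X -> X).
Context (A : subspace V -> subspace V).
Context (C : {linear subspace V -> subspace W}).
Context (FE : is_block V W F A \0 C \0).

Lemma iter_block i (v : subspace V) (w : subspace W) :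
  iter i.+1 F (val v + val w) = val (iter i.+1 A v) + val (C (iter i A v)).
Proof.
by elim: i => [|i IH]; [rewrite /= FE | rewrite iterS IH FE]; rewrite /= !addr0.
Qed.

(** Every power from the first on kills [W], so only the constant coefficient
    acts there; the lower left entries [C A^i] add up to [C q(A)]. *)
Lemma op_poly_block n (a : nat -> K) :
  let p := \poly_(i < n.+1) a i in let q := \poly_(i < n) a i.+1 in
  is_block V W (op_poly p F) (op_poly p A) \0 (C \o op_poly q A)
    (fun w => a 0%N *: w).
Proof.
have recl (Y : normedModType K) (G : Y -> Y) y :
    \sum_(i < n.+1) a i *: iter i G y =
    a 0%N *: y + \sum_(i < n) a i.+1 *: iter i.+1 G y by rewrite big_ord_recl.
move=> p q v w; rewrite /comp !op_poly_poly addr0 !recl.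
rewrite (eq_bigr (fun i : 'I_n => val (a i.+1 *: iter i.+1 A v) +
    val (C (a i.+1 *: iter i A v)))); last first.
  by move=> i _; rewrite iter_block scalerDr !linearZ.
have valD (U : submodClosed X) (x y : subspace U) : val (x + y) = val x + val y.
  exact: raddfD.
have valS (U : submodClosed X) (f : 'I_n -> subspace U) :
    val (\sum_i f i) = \sum_i val (f i) by exact: raddf_sum.
rewrite big_split !linear_sum !valD !valS !linearZ scalerDr addrACA.
by rewrite [X in _ + X]addrC.
Qed.

End BlockPolynomial.

(** * Characterisation of p-hypo-EP operators *)

Theorem theorem3 (R : realType) (H : hilbertType R) (T : boundedOp H H)
    (T1 : boundedOp (subspace (op_range (adjoint T)))
                    (subspace (op_range (adjoint T))))
    (T2 : boundedOp (subspace (op_range (adjoint T))) (subspace (op_ker T)))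
    (n : nat) (a : nat -> R[i]) :
  closed (range T) ->
  is_block (op_range (adjoint T)) (op_ker T) T T1 \0 T2 \0 ->
  let p : {poly R[i]} := \poly_(i < n.+1) a i in
  let q : {poly R[i]} := \poly_(i < n) a i.+1 in
  (hypo_ep p T <-> T2 \o op_poly q T1 = \0) /\
  (hypo_ep p T ->
     is_block (op_range (adjoint T)) (op_ker T)
       (op_poly p T) (op_poly p T1) \0 \0 (fun w => a 0%N *: w)).
Proof.
move=> cT TE p q.
have pTE := op_poly_block TE n a; rewrite -/p -/q /= in pTE.
have pT v : op_poly p T (val v)
    = val (op_poly p T1 v) + val (T2 (op_poly q T1 v)).
  by have := pTE v 0; rewrite scaler0 !addr0.
have P_block (v : subspace (op_range (adjoint T))) (w : subspace (op_ker T)) :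
    mpinv T (T (val v + val w)) = val v.
  rewrite !opD (mpinv_support_fix cT (subspaceP v)).
  by rewrite (mpinv_support_ker (subspaceP w)) addr0.
have iff : hypo_ep p T <-> T2 \o op_poly q T1 = \0.
  split=> [[_ comm]|T2q].
    (* On R(T^* ), P p(T) v = p(T1) v while p(T) P v has the further term
       T2 q(T1) v. *)
    apply/funext => v /=; apply: val_inj.
    have := congr1 (fun F : H -> H => F (val v)) comm.
    rewrite /= pT P_block (mpinv_support_fix cT (subspaceP v)).
    by rewrite pT -[LHS]addr0 => /addrI <-.
  split=> //; apply/funext => x /=.
  pose v := Subspace (mpinv_support_range cT x).
  pose w := Subspace (sub_mpinv_support cT x).
  have xE : x = val v + val w by rewrite /= addrC subrK.
  rewrite [in LHS]xE [in RHS]xE pTE !P_block pT.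
  have -> : T2 (op_poly q T1 v) = 0 by rewrite [LHS](congr1 (@^~ v) T2q).
  by rewrite !addr0.
by split=> // /iff T2q v w; rewrite pTE T2q.
Qed.
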